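(* For every integer $n\geq 1$, \[ C_{4}(n)=\sum_{k\geq 1}(-1)^{k(k+1)/2+1}\,C_{4}\big(n-k(k+1)/2\big). \]
   Context: $C_4(n)$ is the number of partitions of $n$ into parts not congruent to $2$ modulo $4$, with $C_4(0)=1$ and $C_4(m)=0$ for $m<0$. *)

(* Defs.v *)
From mathcomp Require Import all_boot all_order all_algebra.
From mathcomp Require Import zify.

Set Implicit Arguments.
Unset Strict Implicit.
Unset Printing Implicit Defensive.

Definition is_partition (n : nat) (s : seq nat) : bool :=
  [&& sorted geq s, all (fun x => 0 < x) s & sumn s == n].

(* A partition of n has at most n parts, each of them at most n, so the finite
   type n.-bseq 'I_n.+1 contains all of them; see is_partition_bseq. *)
Definition num_partitions (P : pred nat) (n : nat) : nat :=
  #|[set p : n.-bseq 'I_n.+1 | is_partition n (map val p) && all P (map val p)]|.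

Definition C4 (m : int) : nat :=
  if m is Posz n then num_partitions (fun x => x != 2 %[mod 4]) n else 0.

Lemma is_partition_bseq (n : nat) (s : seq nat) :
  is_partition n s -> exists p : n.-bseq 'I_n.+1, map val p = s.
Proof.
case/and3P=> _ pos_s /eqP sum_s.
have size_s : size s <= n.
  rewrite -sum_s; elim: s pos_s {sum_s} => //= x s IHs /andP[x_gt0 /IHs].
  by lia.
have le_s : all (fun x => x < n.+1) s.
  rewrite -sum_s; apply/allP=> x x_s; rewrite ltnS.
  by rewrite sumnE (perm_big _ (perm_to_rem x_s)) big_cons leq_addr.
have size_t : size (map (@inord n) s) <= n by rewrite size_map.
exists (Bseq size_t) => /=.
rewrite -map_comp -[RHS]map_id; apply/eq_in_map => x x_s /=.
by rewrite inordK // (allP le_s).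
Qed.

Lemma C4_0 : C4 0 = 1.
Proof.
rewrite /= /num_partitions; apply/eqP/cards1P; exists [bseq].
by apply/setP=> p; rewrite !inE; case: p => -[|x s] // sz.
Qed.

(* Main.v *)
(** Write [F] for the generating function of [C4], that is
    [F = \prod_(j != 2 mod 4) 1 / (1 - X^j)]. Gauss's identity
    [\sum_k x^(k(k+1)/2) = \prod_k (1 - x^(2k+2)) / (1 - x^(2k+1))] at [x = -X],
    multiplied by [\prod_k (1 - X^(4k+2))
    = \prod_k (1 - X^(2k+1)) (1 + X^(2k+1))], shows that
    [\sum_k (-X)^(k(k+1)/2)] is the inverse of [F]; the recurrence is the vanishing
    of the coefficient of [X^n] in their product. Power series are replaced by
    polynomials modulo a power of [X], and Gauss's identity by Shanks's finite
    version of it. *)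

Require Import Defs.
From mathcomp Require Import all_boot all_order all_algebra.
From mathcomp Require Import classical_sets fsbigop.
From mathcomp Require Import zify ring.

Set Implicit Arguments.
Unset Strict Implicit.
Unset Printing Implicit Defensive.

Import GRing.Theory Num.Theory.

(** * Partitions as plain sequences *)

Section Partitions.
Implicit Types (P Q : pred nat) (m n : nat) (s : seq nat).

(** Plain duplicate-free sequences let counts for different [n] be compared by [uniq_perm], although
    the enclosing finite type depends on [n]. *)
Definition partitions P n : seq (seq nat) :=
  [seq map val p |
     p : n.-bseq 'I_n.+1 <- enum [set p : n.-bseq 'I_n.+1 |
                 is_partition n (map val p) && all P (map val p)]].

Lemma size_partitions P n : size (partitions P n) = num_partitions P n.
Proof. by rewrite size_map -cardE. Qed.

Lemma partitions_uniq P n : uniq (partitions P n).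
Proof.
rewrite map_inj_uniq ?enum_uniq // => p q /(inj_map val_inj) pq.
exact/val_inj.
Qed.

Lemma mem_partitions P n s :
  (s \in partitions P n) = is_partition n s && all P s.
Proof.
apply/mapP/idP => [[p] | /andP[part_s Ps]].
  by rewrite mem_enum inE => ? ->.
have [p pE] := is_partition_bseq part_s.
by exists p => //; rewrite mem_enum inE pE part_s.
Qed.

Lemma is_partition_bounds n s x : is_partition n s -> x \in s -> 0 < x <= n.
Proof.
case/and3P=> _ /allP pos_s /eqP <- x_s; rewrite pos_s //=.
by rewrite sumnE (perm_big _ (perm_to_rem x_s)) big_cons leq_addr.
Qed.

Lemma eq_num_partitions P Q n :
  (forall x, 0 < x <= n -> P x = Q x) -> num_partitions P n = num_partitions Q n.
Proof.
move=> eqPQ; rewrite -!size_partitions; apply/perm_size.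
apply: uniq_perm; rewrite ?partitions_uniq // => s; rewrite !mem_partitions.
case: (boolP (is_partition n s)) => //= part_s.
by apply: eq_in_all => x /(is_partition_bounds part_s) /eqPQ.
Qed.

Lemma num_partitions_pred0 n : num_partitions pred0 n = (n == 0).
Proof.
rewrite -size_partitions.
have memE s : (s \in partitions pred0 n) = (n == 0) && (s == [::]).
  rewrite mem_partitions; case: s => [|x s] /=; last by rewrite !andbF.
  by rewrite /is_partition /= !andbT eq_sym.
case: eqP memE => [_|_] memE.
  rewrite (@perm_size _ _ [:: [::]]) // uniq_perm ?partitions_uniq // => s.
  by rewrite memE inE.
by rewrite (@perm_size _ _ [::]) // uniq_perm ?partitions_uniq.
Qed.

(* Either the largest admissible part j does not occur, or it is the head and
   can be removed. *)
Lemma num_partitions_max_part P j m : 0 < j -> P j -> (forall x, P x -> x <= j) ->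
  num_partitions P (j + m) =
    num_partitions (predI P (predC1 j)) (j + m) + num_partitions P m.
Proof.
move=> j_gt0 Pj leP.
rewrite -!size_partitions -(size_map (cons j) (partitions P m)) -size_cat.
have geq_trans : transitive geq by move=> a b c /= ba ac; exact: leq_trans ac ba.
apply/perm_size/uniq_perm; rewrite ?partitions_uniq //.
  have cons_inj : injective (cons j) by move=> s t [].
  rewrite cat_uniq (map_inj_uniq cons_inj) !partitions_uniq.
  rewrite andbT /=; apply/hasPn => _ /mapP[s _ ->].
  by rewrite mem_partitions /= eqxx !andbF.
move=> s; rewrite mem_cat !mem_partitions.
have -> : (s \in map (cons j) (partitions P m)) =
          if s is x :: t then (x == j) && (t \in partitions P m) else false.
  case: s => [|x t]; first by apply/mapP => -[].
  apply/mapP/andP => [[u u_in [-> ->]]|[/eqP -> t_in]]; first by rewrite eqxx.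
  by exists t.
case: s => [|x t]; first by rewrite /= orbF !andbT.
rewrite mem_partitions /is_partition /= !path_sortedE //.
case: (x =P j) => [->|/eqP x_neq_j].
  rewrite /= !andbF /= Pj j_gt0 eqn_add2l /=.
  case: (boolP (all P t)) => Pt; rewrite ?andbF ?andbT //=.
  suff -> : all (geq j) t by [].
  by apply/allP=> y /(allP Pt) /leP.
rewrite /= orbF andbT.
case: (boolP (P x)) => [Px|]; rewrite ?andbF //=.
case: (boolP (all (geq x) t)) => //= le_t.
congr (_ && _); apply: eq_in_all => y /(allP le_t) /= le_yx.
suff /negbTE -> : y != j by rewrite andbT.
by have := leP _ Px; move: x_neq_j le_yx; lia.
Qed.

End Partitions.

Local Open Scope ring_scope.

(** * Congruence of polynomials modulo a power of [X] *)

Section EqModXn.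
Implicit Types (p q r : {poly int}) (N : nat).

Definition eq_modXn N p q := forall i, (i < N)%N -> p`_i = q`_i.

Lemma eq_modXn_refl N p : eq_modXn N p p.
Proof. by []. Qed.

Lemma eq_modXn_sym N p q : eq_modXn N p q -> eq_modXn N q p.
Proof. by move=> pq i /pq. Qed.

Lemma eq_modXn_trans N p q r : eq_modXn N p q -> eq_modXn N q r -> eq_modXn N p r.
Proof. by move=> pq qr i lt_iN; rewrite pq ?qr. Qed.

Lemma eq_modXnM N p1 p2 q1 q2 :
  eq_modXn N p1 p2 -> eq_modXn N q1 q2 -> eq_modXn N (p1 * q1) (p2 * q2).
Proof.
move=> eqp eqq i lt_iN; rewrite !coefM; apply: eq_bigr => j _.
have := ltn_ord j; rewrite ltnS => le_ji.
by rewrite eqp ?eqq // (leq_ltn_trans _ lt_iN) ?leq_subr.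
Qed.

Lemma eq_modXn_prod1 N (I : eqType) (s : seq I) (A : pred I) (F : I -> {poly int}) :
  (forall i, i \in s -> A i -> eq_modXn N (F i) 1) ->
  eq_modXn N (\prod_(i <- s | A i) F i) 1.
Proof.
move=> F1; rewrite big_seq_cond.
apply: (big_ind (fun p => eq_modXn N p 1)); first exact: eq_modXn_refl.
  by move=> p q p1 q1; rewrite -[1]mulr1; apply: eq_modXnM.
by move=> i /andP[]; apply: F1.
Qed.

Lemma eq_modXn_addXnM N n p q : (N <= n)%N -> eq_modXn N (p + 'X^n * q) p.
Proof.
move=> le_Nn i lt_iN.
by rewrite coefD coefXnM (leq_trans lt_iN le_Nn) addr0.
Qed.

End EqModXn.

(** * Truncated generating functions as inverses of products *)

Section GeneratingFunction.
Implicit Types (P : pred nat) (N J : nat).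

Definition partition_gf N P : {poly int} := \poly_(m < N) (num_partitions P m)%:Z.

(** Coefficientwise this is [num_partitions_max_part]; in degrees below [j] the part [j] cannot
    occur. *)
Lemma partition_gf_rec N P j : (0 < j)%N -> P j -> (forall x, P x -> (x <= j)%N) ->
  eq_modXn N ((1 - 'X^j) * partition_gf N P)
             (partition_gf N (predI P (predC1 j))).
Proof.
move=> j_gt0 Pj leP m lt_mN.
rewrite mulrBl mul1r coefB coefXnM !coef_poly lt_mN.
case: ltnP => [lt_mj|le_jm].
  rewrite subr0; congr _%:Z; apply: eq_num_partitions => x /andP[_ le_xm] /=.
  by rewrite neq_ltn (leq_ltn_trans le_xm lt_mj) andbT.
rewrite (leq_ltn_trans (leq_subr _ _) lt_mN) -{1 3}(subnKC le_jm).
by rewrite num_partitions_max_part // PoszD addrK.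
Qed.

(** Induction on the bound [J], kept apart from the precision [N]: each factor removes one
    admissible part, until only the empty partition is left. *)
Lemma partition_gf_bounded N P J :
  eq_modXn N ((\prod_(1 <= j < J.+1 | P j) (1 - 'X^j)) *
              partition_gf N (fun x => P x && (0 < x <= J)%N)) 1.
Proof.
elim: J => [|J IHJ].
  rewrite big_geq // mul1r => m lt_mN; rewrite coef_poly lt_mN coef1.
  rewrite (@eq_num_partitions _ pred0) ?num_partitions_pred0; first by case: eqP.
  by move=> x _ /=; rewrite leqn0; case: x => [|x]; rewrite ?andbF.
rewrite big_mkcond big_nat_recr //= -big_mkcond /=.
have eqPJ x : x != J.+1 -> (x <= J.+1)%N = (x <= J)%N by lia.
case: ifP => PJ.
  rewrite -mulrA; apply: eq_modXn_trans IHJ.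
  apply: eq_modXnM => //.
  apply: (@eq_modXn_trans _ _ (partition_gf N
    (predI (fun x => P x && (0 < x <= J.+1)%N) (predC1 J.+1)))).
    by apply: partition_gf_rec => //= [|x]; [rewrite PJ leqnn | lia].
  move=> m lt_mN; rewrite !coef_poly lt_mN; congr _%:Z.
  by apply: eq_num_partitions => x _ /=; case: (P x) => //=; lia.
rewrite mulr1; apply: eq_modXn_trans IHJ; apply: eq_modXnM => //.
move=> m lt_mN; rewrite !coef_poly lt_mN; congr _%:Z.
apply: eq_num_partitions => x _ /=.
by have [->|/eqPJ ->//] := eqVneq x J.+1; rewrite PJ.
Qed.

(** Parts of a partition of [m <= N] are at most [N], so the bound [J = N] excludes nothing. *)
Lemma partition_gfE N P :
  eq_modXn N.+1 ((\prod_(1 <= j < N.+1 | P j) (1 - 'X^j)) * partition_gf N.+1 P) 1.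
Proof.
apply: eq_modXn_trans (@partition_gf_bounded _ P N); apply: eq_modXnM => //.
move=> m lt_mN; rewrite !coef_poly lt_mN; congr _%:Z.
by apply: eq_num_partitions => x /andP[x_gt0 le_xm] /=; case: (P x) => //=; lia.
Qed.

End GeneratingFunction.

(** * Gauss's identity for triangular exponents *)

Section Gauss.

Definition tri (k : nat) : nat := (k * (k + 1)) %/ 2.

Lemma tri_double n : tri n.*2 = (n * n.*2.+1)%N.
Proof. by rewrite /tri -(@mulnK (n * n.*2.+1) 2) //; congr (_ %/ _)%N; nia. Qed.

Lemma tri_doubleS n : tri n.*2.+1 = (n.+1 * n.*2.+1)%N.
Proof. by rewrite /tri -(@mulnK (n.+1 * n.*2.+1) 2) //; congr (_ %/ _)%N; nia. Qed.

Variables (R : comNzRingType) (x : R).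

Definition odd_factors (n : nat) : R := \prod_(k < n) (1 - x ^+ k.*2.+1).

Definition even_factors (s n : nat) : R := \prod_(s <= k < n) (1 - x ^+ k.*2.+2).

Lemma odd_factorsS n : odd_factors n.+1 = odd_factors n * (1 - x ^+ n.*2.+1).
Proof. by rewrite /odd_factors big_ord_recr. Qed.

Lemma even_factorsS s n : (s <= n)%N ->
  even_factors s n.+1 = even_factors s n * (1 - x ^+ n.*2.+2).
Proof. by move=> le_sn; rewrite /even_factors big_nat_recr. Qed.

Lemma even_factors_recl s n : (s < n)%N ->
  even_factors s n = (1 - x ^+ s.*2.+2) * even_factors s.+1 n.
Proof. by move=> lt_sn; rewrite /even_factors big_ltn. Qed.

(** For [s > 0] the summand is the difference of the right-hand side at [t = s] and at [t = s - 1].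
    The factor [1 - x ^+ n.*2.+1] is the one that [odd_factors] gains from [n] to [n.+1]. *)
Lemma shanks_telescope n t : (t <= n)%N ->
  \sum_(s < t.+1) (even_factors s n.+1 * odd_factors s * x ^+ (s * n.+1.*2.+1)
     - (1 - x ^+ n.*2.+1) * (even_factors s n * odd_factors s * x ^+ (s * n.*2.+1)))
  = even_factors t n * odd_factors t.+1 * x ^+ (t.+1 * n.*2.+1).
Proof.
elim: t => [_|t IHt lt_tn].
  rewrite big_ord_recl big_ord0 addr0 /= even_factorsS // odd_factorsS.
  rewrite !mul0n !mul1n expr0 /odd_factors big_ord0 /= !exprS expr0; ring.
rewrite big_ord_recr /= (IHt (ltnW lt_tn)) (even_factors_recl lt_tn).
rewrite even_factorsS // (odd_factorsS t.+1).
(* This isolates [x ^+ t.*2.+2], the power in the factor released by [even_factors_recl]. *)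
have -> : (t.+1 * n.+1.*2.+1 = t.+1 * n.*2.+1 + t.*2.+2)%N by nia.
rewrite [(t.+2 * _)%N]mulSn doubleS !exprD (exprS x n.*2.+1) (exprS x t.*2.+2).
ring.
Qed.

(* D. Shanks, Two theorems of Gauss (1958): only the summand s = 0 on the right
   has terms of degree at most 2n, which yields Gauss's identity in the limit. *)
Lemma shanks_identity n :
  odd_factors n * \sum_(k < n.*2) x ^+ tri k =
  \sum_(s < n) even_factors s n * odd_factors s * x ^+ (s * n.*2.+1).
Proof.
elim: n => [|n IHn]; first by rewrite !big_ord0 mulr0.
rewrite doubleS !big_ord_recr /= tri_double tri_doubleS.
apply/eqP; rewrite -subr_eq0 -oppr_eq0 opprB; apply/eqP.
(* At [t = n] the telescoped value gives the term of exponent [tri n.*2.+1]; the summand [s = n] at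
   level [n], absent from the induction hypothesis, gives that of exponent [tri n.*2]. *)
have := shanks_telescope (leqnn n).
rewrite sumrB -mulr_sumr !big_ord_recr /= -IHn.
have -> : even_factors n n = 1 by rewrite /even_factors big_geq.
rewrite odd_factorsS doubleS => /eqP; rewrite subr_eq => /eqP ->; ring.
Qed.

End Gauss.

Lemma gauss_modXn n : (0 < n)%N ->
  eq_modXn n.*2.+1 (odd_factors (- 'X) n * \sum_(k < n.*2) (- 'X) ^+ tri k)
                   (even_factors (- 'X : {poly int}) 0 n).
Proof.
rewrite shanks_identity; case: n => // n _.
set N := n.+1.*2.+1.
rewrite big_ord_recl /= mul0n expr0 mulr1 /odd_factors big_ord0 mulr1.
have signM (p : {poly int}) : (- 'X) ^+ N * p = 'X^N * ((-1) ^+ N * p).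
  by rewrite [(- 'X) ^+ N]exprNn -mulrA mulrCA.
under eq_bigr => i _ do rewrite /= mulSn exprD mulrCA signM.
by rewrite -mulr_sumr; apply: eq_modXn_addXnM.
Qed.

(** * Sorting the factors by their exponent modulo 4 *)

Lemma odd_factors_sqr (R : comNzRingType) (x : R) n :
  odd_factors x n * odd_factors (- x) n = \prod_(k < n) (1 - x ^+ (4 * k + 2)).
Proof.
rewrite -big_split; apply: eq_bigr => k _ /=.
have -> : (4 * k + 2 = k.*2.+1 + k.*2.+1)%N by lia.
have -> : (- x) ^+ k.*2.+1 = - x ^+ k.*2.+1.
  by rewrite exprNn -signr_odd /= odd_double /= expr1 mulN1r.
rewrite exprD; ring.
Qed.

(** Even powers do not see the sign of [x], so odd and even exponents together exhaust 1 to
    [n.*2]. *)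
Lemma all_factors (R : comNzRingType) (x : R) n :
  odd_factors x n * even_factors (- x) 0 n = \prod_(1 <= j < n.*2.+1) (1 - x ^+ j).
Proof.
elim: n => [|n IHn]; first by rewrite /odd_factors /even_factors big_ord0 !big_geq ?mulr1.
rewrite odd_factorsS even_factorsS // doubleS big_nat_recr // big_nat_recr //= -IHn.
have -> : (- x) ^+ n.*2.+2 = x ^+ n.*2.+2.
  by rewrite exprNn -signr_odd /= odd_double /= expr0 mul1r.
ring.
Qed.

Lemma prod_mod4_eq2 (R : comNzRingType) (F : nat -> R) n :
  \prod_(1 <= j < (4 * n).+1 | j == 2 %[mod 4]) F j = \prod_(k < n) F (4 * k + 2)%N.
Proof.
elim: n => [|n IHn]; first by rewrite big_geq // big_ord0.
rewrite big_ord_recr -IHn big_mkcond /= [in RHS]big_mkcond /=.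
have -> : (4 * n.+1 = (4 * n).+4)%N by lia.
do 4 (rewrite big_nat_recr //=).
have -> : ((4 * n).+1 == 2 %[mod 4]) = false by lia.
have -> : ((4 * n).+2 == 2 %[mod 4]) = true by lia.
have -> : ((4 * n).+3 == 2 %[mod 4]) = false by lia.
have -> : ((4 * n).+4 == 2 %[mod 4]) = false by lia.
by rewrite !mulr1 addn2.
Qed.

(** The factors with [j > n.*2] are 1 at this precision. *)
Lemma prod_mod4_modXn n :
  eq_modXn n.*2.+1 (\prod_(k < n) (1 - 'X^(4 * k + 2)))
                   (\prod_(1 <= j < n.*2.+1 | j == 2 %[mod 4]) (1 - 'X^j)).
Proof.
rewrite -(prod_mod4_eq2 (fun j => 1 - 'X^j)).
rewrite (@big_cat_nat _ _ _ n.*2.+1) //=; last by lia.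
rewrite -[X in eq_modXn _ _ X]mulr1; apply: eq_modXnM => //.
apply: eq_modXn_prod1 => j; rewrite mem_index_iota => /andP[le_nj _] _.
by rewrite -mulrN1; apply: eq_modXn_addXnM.
Qed.

Lemma tri_series_inverse n : (0 < n)%N ->
  eq_modXn n.*2.+1
    ((\sum_(k < n.*2) (- 'X) ^+ tri k) *
     partition_gf n.*2.+1 (fun x => x != 2 %[mod 4])) 1.
Proof.
move=> n_gt0; set S := \sum_(k < _) _; set F := partition_gf _ _.
set N := n.*2.+1.
(* [G] serves as an inverse of [M2], by which the common factor in [M2S] is cancelled. *)
pose G := partition_gf N (fun x => x == 2 %[mod 4]).
pose M2 : {poly int} := \prod_(1 <= j < N | j == 2 %[mod 4]) (1 - 'X^j).
pose E : {poly int} := \prod_(1 <= j < N | j != 2 %[mod 4]) (1 - 'X^j).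
have M2G : eq_modXn N (M2 * G) 1 by apply: partition_gfE.
have EF : eq_modXn N (E * F) 1 by apply: (@partition_gfE _ (fun x => x != 2 %[mod 4])).
(* Both sides agree with the product of all [1 - 'X^j], [j < N]: on the left [M2] splits into odd
   factors at ['X] and [- 'X], and the latter turn [S] into even factors. *)
have M2S : eq_modXn N (M2 * S) (M2 * E).
  have -> : M2 * E = odd_factors 'X n * even_factors (- 'X) 0 n.
    by rewrite all_factors (bigID (fun j => j == 2 %[mod 4])).
  apply: (@eq_modXn_trans _ _ (odd_factors 'X n * odd_factors (- 'X) n * S)).
    apply: eq_modXnM => //; rewrite odd_factors_sqr.
    by apply: eq_modXn_sym; apply: prod_mod4_modXn.
  by rewrite -mulrA; apply: eq_modXnM => //; apply: gauss_modXn.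
apply: (@eq_modXn_trans _ _ (M2 * G * (S * F))).
  rewrite -[X in eq_modXn _ X]mul1r; apply: eq_modXnM => //.
  exact: eq_modXn_sym.
apply: (@eq_modXn_trans _ _ (M2 * E * (G * F))).
  have -> : M2 * G * (S * F) = M2 * S * (G * F) by ring.
  exact: eq_modXnM.
have -> : M2 * E * (G * F) = (M2 * G) * (E * F) by ring.
by rewrite -[1]mulr1; apply: eq_modXnM.
Qed.

(** * Reading off the recurrence *)

Lemma C4_subn m t :
  C4 (m%:Z - t%:Z) =
    if (m < t)%N then 0%N else num_partitions (fun x => x != 2 %[mod 4]) (m - t).
Proof.
case: ltnP => [lt_mt|le_tm]; last by rewrite subzn.
by have -> : m%:Z - t%:Z = Negz (t - m).-1 by lia.
Qed.

Lemma C4_tri_sum m : (0 < m)%N ->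
  \sum_(k < m.*2) (-1) ^+ tri k * (C4 (m%:Z - (tri k)%:Z))%:Z = 0.
Proof.
(* With [n = m] the precision [m.*2.+1] covers the coefficient of [X^m], which vanishes in 1 since
   [m > 0]. *)
move=> m_gt0; have /(_ m) := tri_series_inverse m_gt0.
rewrite -addnn !ltnS leq_addr coef1 gtn_eqF // => /(_ isT); apply: etrans.
rewrite mulr_suml coef_sum; apply: eq_bigr => k _.
rewrite (exprNn 'X) -mulrA -(rmorph_sign polyC) coefCM coefXnM C4_subn; case: ltnP => // le_tm.
by rewrite coef_poly ltnS (leq_trans (leq_subr _ _) (leq_addr _ _)).
Qed.

Lemma leq_tri k : (k <= tri k)%N.
Proof. by rewrite /tri leq_divRL //; case: k => // k; nia. Qed.

Local Open Scope classical_set_scope.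
Local Open Scope ring_scope.

Theorem theorem9 (n : int) (hn : 1 <= n) :
  (C4 n)%:Z =
    \sum_(k \in [set k : nat | (1 <= k)%N])
      (-1) ^+ ((k * (k + 1)) %/ 2 + 1)%N *
      (C4 (n - ((k * (k + 1)) %/ 2)%N%:Z))%:Z.
Proof.
case: n hn => // m m_gt0.
have {}m_gt0 : (0 < m)%N by lia.
(* The support is finite: [k >= m.*2] forces [tri k >= k > m], where [C4] gets a negative
   argument. *)
rewrite (fsbigE (index_iota 1 m.*2)) ?iota_uniq //=; first last.
- move=> k k_gt0; rewrite mem_index_iota k_gt0 -leqNgt => le_mk.
  rewrite -/(tri k) C4_subn ifT ?mulr0 //.
  by apply: leq_trans (leq_tri k); lia.
- by move=> k /=; rewrite mem_index_iota => /andP[].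
have := C4_tri_sum m_gt0.
rewrite -(big_mkord xpredT (fun k => (-1) ^+ tri k * (C4 (m%:Z - (tri k)%:Z))%:Z)).
(* The term [k = 0] is [C4 m]; moving the others across the equation produces the extra [+ 1] in the
   exponent of the sign. *)
rewrite big_ltn ?double_gt0 // /tri mul0n div0n expr0 mul1r subr0.
move/eqP; rewrite addr_eq0 => /eqP ->.
rewrite -sumrN big_seq [RHS]big_seq_cond.
apply: eq_big => [k|k _]; last by rewrite exprD expr1 mulrN1 mulNr.
rewrite mem_index_iota; case: andP => [[k_gt0 _]|] //=.
by apply/esym/mem_set.
Qed.
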